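(* Let $G$ be a graph on $n$ vertices, and let $m>0$ be an integer. Then $$\operatorname{depth}_E W(G,m)=m\,\operatorname{depth}_E W(G,1).$$
   Context: Let $\mathbf{k}$ be an algebraically closed field of characteristic zero. Graphs are finite and simple. For a graph $G$ and an integer $m>0$, $W(G,m)$ denotes the graph formed by attaching $m$ new degree-one vertices to each vertex of $G$. For a graph $H$ with vertices $v_1,\dots,v_N$, let $E=\bigwedge_{\mathbf k}\langle e_1,\dots,e_N\rangle$ be the exterior algebra over $\mathbf{k}$ in $N$ variables, with degree-one part $E_1$, and let $I_E(H)=(e_ie_j \mid \{v_i,v_j\}\text{ is an edge of }H)\subseteq E$. For a graded $E$-module $M$, an element $\ell\in E_1$ is $M$-regular if $\{y\in M\mid \ell y=0\}=\ell M$. A sequence $\ell_1,\dots,\ell_r\in E_1$ is an $M$-regular sequence if $\ell_i$ is regular on $M/(\ell_1,\dots,\ell_{i-1})M$ for all $i\le r$; $\operatorname{depth}_E M$ is the maximum length of an $M$-regular sequence. Write $\operatorname{depth}_E H=\operatorname{depth}_E E/I_E(H)$, where $E$ is the exterior algebra on the vertices of $H$. The empty graph has depth $0$. *)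

(* Defs.v *)
From HB Require Import structures.
From mathcomp Require Import all_boot all_order all_algebra.
From mathcomp Require Import boolp ring.

Set Implicit Arguments.
Unset Strict Implicit.
Unset Printing Implicit Defensive.

Import GRing.Theory.
Local Open Scope ring_scope.

(** * Exterior algebra on the vector space with basis a finite type [V]

    The basis element attached to [A : {set V}] is the product of the
    generators [e_v], [v \in A], taken in increasing order of [enum_rank];
    an element is the family of its coordinates in this basis. *)

Definition extalg (k : fieldType) (V : finType) := {ffun {set V} -> k^o}.

HB.instance Definition _ (k : fieldType) (V : finType) :=
  Vector.on (extalg k V).

(** For disjoint [A] and [B],
    [e_A * e_B = (-1) ^+ ninv A B *: e_(A :|: B)]. *)
Definition ninv (V : finType) (A B : {set V}) : nat :=
  \sum_(a in A) \sum_(b in B) (enum_rank b < enum_rank a).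

Section ExteriorAlgebra.
Variables (k : fieldType) (V : finType).
Implicit Types (x y z : extalg k V) (A B C D : {set V}).

Definition ext_mul x y : extalg k V :=
  [ffun C : {set V} => \sum_(A : {set V} | A \subset C)
     (-1) ^+ ninv A (C :\: A) * (x A : k) * (y (C :\: A) : k) : k^o].

Definition ext_one : extalg k V := [ffun C : {set V} => (C == set0)%:R : k^o].

Lemma ninv0s A : ninv set0 A = 0%N.
Proof. by rewrite /ninv big_set0. Qed.

Lemma ninvs0 A : ninv A set0 = 0%N.
Proof. by rewrite /ninv big1 // => a _; rewrite big_set0. Qed.

Lemma ninvUl A B C : [disjoint A & B] ->
  ninv (A :|: B) C = (ninv A C + ninv B C)%N.
Proof. by move=> dAB; rewrite /ninv -bigU //=; apply: eq_bigl => a; rewrite !inE. Qed.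

Lemma ninvUr A B C : [disjoint B & C] ->
  ninv A (B :|: C) = (ninv A B + ninv A C)%N.
Proof.
move=> dBC; rewrite /ninv -big_split; apply: eq_bigr => a _ /=.
by rewrite -bigU //=; apply: eq_bigl => b; rewrite !inE.
Qed.

Lemma ext_mulA : associative ext_mul.
Proof.
move=> x y z; apply/ffunP => D; rewrite !ffunE.
transitivity (\sum_(A : {set V} | A \subset D)
   \sum_(C : {set V} | (C \subset D) && (A \subset C))
    (-1) ^+ (ninv A (C :\: A) + ninv C (D :\: C))
      * (x A : k) * (y (C :\: A) : k) * (z (D :\: C) : k)).
  apply: eq_bigr => A sAD; rewrite ffunE mulr_sumr.
  rewrite (reindex_onto (fun C : {set V} => C :\: A)
    (fun B => A :|: B)) /=; last first.
    move=> B; rewrite subsetD => /andP[_ dBA].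
    rewrite setDUl setDv set0U; apply/setDidPl; exact: dBA.
  apply: eq_big => [C | C].
    apply/andP/andP => [[sCD /eqP <-] | [sCD sAC]].
      split; last exact: subsetUl.
      by rewrite subUset sAD (subset_trans sCD) ?subsetDl.
    split; first exact: setSD.
    apply/eqP/setP=> v; rewrite !inE; have /implyP := subsetP sAC v.
    by case: (v \in A).
  case/andP=> sCD /eqP eC.
  have sAC : A \subset C by rewrite -eC subsetUl.
  have sC : C \subset D.
    by rewrite -eC subUset sAD (subset_trans sCD) ?subsetDl.
  have eD : D :\: A :\: (C :\: A) = D :\: C.
    apply/setP=> v; rewrite !inE.
    by have /implyP := subsetP sAC v; case: (v \in A); case: (v \in C);
       case: (v \in D).
  rewrite eD.
  have -> : D :\: A = (C :\: A) :|: (D :\: C).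
    apply/setP=> v; rewrite !inE.
    have /implyP := subsetP sAC v; have /implyP := subsetP sC v.
    by case: (v \in A); case: (v \in C); case: (v \in D).
  have d1 : [disjoint C :\: A & D :\: C].
    rewrite -setI_eq0; apply/eqP/setP=> v; rewrite !inE.
    by case: (v \in C); rewrite ?andbF.
  rewrite ninvUr //.
  have -> : ninv C (D :\: C) = (ninv A (D :\: C) + ninv (C :\: A) (D :\: C))%N.
    rewrite -ninvUl; last first.
      by rewrite -setI_eq0; apply/eqP/setP=> v; rewrite !inE; case: (v \in A).
    by congr ninv; rewrite -{1}eC; apply/setP=> v; rewrite !inE; case: (v \in A).
  by rewrite !exprD; ring.
rewrite (exchange_big_dep (fun C : {set V} => C \subset D)) /=; last first.
  by move=> A C _ /andP[].
apply: eq_bigr => C sCD; rewrite ffunE mulr_sumr mulr_suml.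
apply: eq_big => [A | A /andP[_ /andP[_ sAC]]].
  by rewrite sCD; apply: andb_idl => sAC; apply: subset_trans sCD.
by rewrite exprD !mulrA; congr (_ * _ * _ * _); rewrite mulrC.
Qed.

Lemma ext_mul1l : left_id ext_one ext_mul.
Proof.
move=> x; apply/ffunP => C; rewrite ffunE (bigD1 (set0 : {set V})) ?sub0set //= big1.
  by rewrite ninv0s setD0 ffunE eqxx expr0 !mul1r addr0.
by move=> A /andP[_ /negPf A0]; rewrite ffunE A0 mulr0 mul0r.
Qed.

Lemma ext_mul1r : right_id ext_one ext_mul.
Proof.
move=> x; apply/ffunP => C; rewrite ffunE (bigD1 C) //= big1.
  by rewrite setDv ninvs0 ffunE eqxx expr0 mul1r mulr1 addr0.
move=> A /andP[sAC nAC]; rewrite ffunE setD_eq0.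
case: (boolP (C \subset A)) => [sCA|_]; last by rewrite mulr0.
by rewrite eqEsubset sAC sCA in nAC.
Qed.

Lemma ext_mulDl : left_distributive ext_mul +%R.
Proof.
move=> x y z; apply/ffunP => C; rewrite !ffunE -big_split.
by apply: eq_bigr => A _; rewrite !ffunE mulrDr mulrDl.
Qed.

Lemma ext_mulDr : right_distributive ext_mul +%R.
Proof.
move=> x y z; apply/ffunP => C; rewrite !ffunE -big_split.
by apply: eq_bigr => A _; rewrite !ffunE mulrDr.
Qed.

Lemma ext_one_neq0 : ext_one != 0.
Proof.
by apply/eqP=> /ffunP/(_ set0); rewrite !ffunE eqxx; apply/eqP/oner_neq0.
Qed.

HB.instance Definition _ := GRing.Zmodule_isNzRing.Build (extalg k V)
  ext_mulA ext_mul1l ext_mul1r ext_mulDl ext_mulDr ext_one_neq0.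

Lemma ext_scaleAl (a : k) x y : a *: (x * y) = (a *: x) * y.
Proof.
apply/ffunP => C; rewrite !ffunE [LHS]mulr_sumr; apply: eq_bigr => A _.
by rewrite ffunE /GRing.scale /=; ring.
Qed.

HB.instance Definition _ := GRing.Lmodule_isLalgebra.Build k (extalg k V)
  ext_scaleAl.

Lemma ext_scaleAr (a : k) x y : a *: (x * y) = x * (a *: y).
Proof.
apply/ffunP => C; rewrite !ffunE [LHS]mulr_sumr; apply: eq_bigr => A _.
by rewrite ffunE /GRing.scale /=; ring.
Qed.

HB.instance Definition _ := GRing.Lalgebra_isAlgebra.Build k (extalg k V)
  ext_scaleAr.

Definition ext_basis A : extalg k V := [ffun C => (C == A)%:R : k^o].

Lemma ext_basisM A B : ext_basis A * ext_basis B =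
  if [disjoint A & B] then (-1) ^+ ninv A B *: ext_basis (A :|: B) else 0.
Proof.
apply/ffunP => C; rewrite ffunE.
have -> : (\sum_(A' : {set V} | A' \subset C) (-1) ^+ ninv A' (C :\: A') *
     (ext_basis A A' : k) * (ext_basis B (C :\: A') : k)) =
    (if (A \subset C) && (C :\: A == B) then (-1) ^+ ninv A B else 0 : k).
  rewrite (eq_bigr (fun A' : {set V} => if A' == A then
     (if C :\: A == B then (-1) ^+ ninv A B else 0) else 0 : k)); last first.
    move=> D _; rewrite !ffunE; case: eqP => [->|_]; last by rewrite mulr0 mul0r.
    by case: eqP => [->|_]; rewrite !mulr1 // mulr0.
  rewrite -big_mkcondr /=.
  case: (boolP (A \subset C)) => sAC /=; last first.
    by rewrite big_pred0 // => D; case: eqP => [->|]; rewrite ?andbF // (negPf sAC).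
  rewrite (big_pred1 A) // => D; rewrite /= andb_idl //.
  by move/eqP->.
case: (boolP [disjoint A & B]) => [dAB|ndAB]; last first.
  rewrite ffunE; case: ifP => // /andP[_ /eqP eB]; case/negP: ndAB.
  by rewrite -eB -setI_eq0; apply/eqP/setP=> v; rewrite !inE; case: (v \in A).
rewrite !ffunE /GRing.scale /=.
have -> : (A \subset C) && (C :\: A == B) = (C == A :|: B).
  apply/andP/eqP => [[sAC /eqP <-] | ->].
    apply/setP=> v; rewrite !inE; have /implyP := subsetP sAC v.
    by case: (v \in A).
  split; first exact: subsetUl.
  by rewrite setDUl setDv set0U; apply/eqP/setDidPl; rewrite disjoint_sym.
by case: eqP; rewrite ?mulr1 ?mulr0.
Qed.

Definition ext_gen (v : V) : extalg k V := ext_basis [set v].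

Lemma ext_gen_sq v : ext_gen v * ext_gen v = 0.
Proof. by rewrite ext_basisM disjoints1 inE eqxx. Qed.

Lemma ext_gen_anticomm u v : ext_gen u * ext_gen v = - (ext_gen v * ext_gen u).
Proof.
case: (eqVneq u v) => [->|nuv]; first by rewrite ext_gen_sq oppr0.
rewrite !ext_basisM !disjoints1 !inE nuv eq_sym nuv /= [[set v] :|: _]setUC.
rewrite -scaleNr; congr (_ *: _); rewrite /ninv !big_set1.
case: ltngtP => [||/val_inj/enum_rank_inj evu]; rewrite ?expr0 ?expr1 ?opprK //.
by rewrite evu eqxx in nuv.
Qed.

Definition ext1 : {vspace extalg k V} := <<codom ext_gen>>%VS.

End ExteriorAlgebra.

(** * Two-sided ideals *)

Definition is_ideal (R : nzRingType) (J : R -> Prop) : Prop :=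
  [/\ J 0, forall x y, J x -> J y -> J (x + y),
      forall a x, J x -> J (a * x) & forall a x, J x -> J (x * a)].

Definition ideal_gen (R : nzRingType) (S : R -> Prop) (x : R) : Prop :=
  forall J : R -> Prop, is_ideal J -> (forall s, S s -> J s) -> J x.

Section Ideals.
Variable R : nzRingType.

Lemma is_ideal_gen (S : R -> Prop) : is_ideal (ideal_gen S).
Proof.
split=> [J [] | x y Sx Sy J iJ sSJ | a x Sx J iJ sSJ | a x Sx J iJ sSJ] //.
- by case: (iJ) => _ D _ _; apply: D; [apply: Sx | apply: Sy].
- by case: (iJ) => _ _ M _; apply: M; apply: Sx.
- by case: (iJ) => _ _ _ M; apply: M; apply: Sx.
Qed.

Lemma ideal_genS (S : R -> Prop) s : S s -> ideal_gen S s.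
Proof. by move=> Ss J _; apply. Qed.

End Ideals.

(** * Regular sequences and depth of the cyclic modules [E / J]

    Elements of [E / J] are given by representatives in [E], and
    [(l_1, ..., l_i) (E / J)] is the image of the ideal of [E] generated by
    [J] and [l_1, ..., l_i]. *)
Section Depth.
Variables (k : fieldType) (V : finType).
Local Notation E := (extalg k V).
Implicit Types (J : E -> Prop) (l : E) (ls : seq E).

(** [{y in E / J | l * y = 0} = l (E / J)] *)
Definition regular_on J l : Prop :=
  forall y : E, J (l * y) <-> exists z : E, J (y - l * z).

Definition adjoin_ideal J ls : E -> Prop :=
  ideal_gen (fun x => J x \/ x \in ls).

Definition regular_seq J ls : Prop :=
  {subset ls <= ext1 k V} /\
  forall i, (i < size ls)%N -> regular_on (adjoin_ideal J (take i ls)) ls`_i.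

(** The range of lengths is large enough whenever [J] has no element with a
    nonzero constant term; see [depth_modP] below. *)
Definition depth_mod J : nat :=
  \max_(r < #|V|.+1 | `[< exists ls, regular_seq J ls /\ size ls = r >]) r.

Lemma ext_mul_const (x y : E) :
  (x * y) set0 = (x set0 : k) * (y set0 : k) :> k.
Proof.
rewrite ffunE (big_pred1 set0) => [|A]; last by rewrite subset0.
by rewrite setD0 ninv0s expr0 mul1r.
Qed.

Lemma is_ideal_const : is_ideal (fun x : E => x set0 = 0).
Proof.
split=> [|x y x0 y0|a x x0|a x x0]; first by rewrite ffunE.
- by rewrite ffunE x0 y0 addr0.
- by rewrite ext_mul_const x0 mulr0.
- by rewrite ext_mul_const x0 mul0r.
Qed.

Lemma regular_seq_size J ls : (forall x, J x -> x set0 = 0) ->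
  regular_seq J ls -> (size ls <= #|V|)%N.
Proof.
move=> J0 [sls reg].
have ext1_0 (l : E) : l \in ext1 k V -> l set0 = 0.
  rewrite /ext1 -[codom _]/(tval (in_tuple _)) => /coord_span ->.
  rewrite sum_ffunE big1 // => i _; rewrite ffunE.
  have /codomP[v ->] := mem_nth 0 (ltn_ord i).
  by rewrite ffunE eq_sym -cards_eq0 cards1 scaler0.
have free_take i : (i <= size ls)%N -> free (take i ls).
  elim: i => [|i IHi] lti; first by rewrite take0 nil_free.
  rewrite (take_nth 0) // (perm_free (permEl (perm_rcons _ _))) free_cons.
  rewrite IHi ?(ltnW lti) // andbT; apply/negP => l_span.
  set K := adjoin_ideal J (take i ls).
  have iK : is_ideal K by apply: is_ideal_gen.
  have K_l : K ls`_i.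
    case: (iK) => K0 KD KM _.
    move: l_span; rewrite -[take _ _]/(tval (in_tuple _)) => /coord_span ->.
    elim/big_ind: _ => // j _; rewrite -mulr_algl; apply: KM.
    by apply: ideal_genS; right; apply: mem_nth.
  have [|z Kz] := (reg i lti 1).1; first by rewrite mulr1.
  have K1 : K 1.
    case: (iK) => _ KD _ KMr.
    by rewrite -(subrK (ls`_i * z) 1); apply: KD => //; apply: KMr.
  have /eqP : (1 : E) set0 = 0.
    apply: (K1 _ is_ideal_const) => s [/J0//|/mem_take/sls]; exact: ext1_0.
  by rewrite ffunE eqxx; apply/negP/oner_neq0.
have /eqP <- : free ls by rewrite -[ls]take_size; apply: free_take.
apply: leq_trans (_ : \dim (ext1 k V) <= _)%N.
  by apply: dimvS; apply/span_subvP.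
by apply: leq_trans (dim_span _) _; rewrite size_codom.
Qed.

(** [depth_mod J] is the maximum length of a regular sequence. *)
Lemma depth_modP J : (forall x, J x -> x set0 = 0) ->
  (exists ls, regular_seq J ls /\ size ls = depth_mod J) /\
  (forall ls, regular_seq J ls -> (size ls <= depth_mod J)%N).
Proof.
move=> J0; split=> [|ls rls]; last first.
  have lt_ls : (size ls < #|V|.+1)%N by rewrite ltnS (regular_seq_size J0).
  apply: (leq_bigmax_cond (Ordinal lt_ls)) => /=.
  by apply/asboolP; exists ls.
rewrite /depth_mod.
pose P := [pred r : 'I_#|V|.+1 |
  `[< exists ls, regular_seq J ls /\ size ls = r >]].
have P0 : (0 < #|P|)%N.
  by apply/card_gt0P; exists ord0; apply/asboolP; exists [::].
by have [r /asboolP Pr ->] := eq_bigmax_cond (fun r : 'I_#|V|.+1 => r : nat) P0.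
Qed.

End Depth.

(** * Graphs *)

Record sgraph := SGraph {
  svertex :> finType;
  sedge : rel svertex;
  sedge_sym : symmetric sedge;
  sedge_irrefl : irreflexive sedge }.

(** The vertices of [W(G, m)] are those of [G] and, for each [x : G], the [m]
    new vertices [(x, i)], [i < m]. *)
Section Whisker.
Variables (G : sgraph) (m : nat).

Definition whisker_edge : rel (G + G * 'I_m)%type := fun u v =>
  match u, v with
  | inl x, inl y => sedge x y
  | inl x, inr (y, _) => x == y
  | inr (x, _), inl y => x == y
  | inr _, inr _ => false
  end.

Lemma whisker_sym : symmetric whisker_edge.
Proof.
by move=> [x|[x i]] [y|[y j]] //=; [exact: sedge_sym | exact: eq_sym ..].
Qed.

Lemma whisker_irrefl : irreflexive whisker_edge.
Proof. by move=> [x|[x i]] //=; exact: sedge_irrefl. Qed.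

Definition whisker : sgraph := SGraph whisker_sym whisker_irrefl.

End Whisker.

Section EdgeIdeal.
Variables (k : fieldType) (H : sgraph).

Definition edge_ideal : extalg k H -> Prop :=
  ideal_gen (fun x => exists u v : H,
    sedge u v /\ x = ext_gen k u * ext_gen k v).

Lemma edge_ideal_const x : edge_ideal x -> x set0 = 0.
Proof.
move=> /(_ _ (is_ideal_const k H)); apply.
move=> _ [u [v [_ ->]]]; rewrite ext_mul_const.
by rewrite ffunE eq_sym -cards_eq0 cards1 mul0r.
Qed.

Definition depthE : nat := depth_mod edge_ideal.

Lemma depthEP :
  (exists ls, regular_seq edge_ideal ls /\ size ls = depthE) /\
  (forall ls, regular_seq edge_ideal ls -> (size ls <= depthE)%N).
Proof. exact: depth_modP edge_ideal_const. Qed.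

Lemma depthE_empty : #|H| = 0%N -> depthE = 0%N.
Proof.
move=> H0; have [[ls [rls <-]] _] := depthEP.
apply/eqP; rewrite -leqn0 -H0; apply: regular_seq_size rls.
exact: edge_ideal_const.
Qed.

End EdgeIdeal.

(* Main.v *)
Require Import Defs.
From mathcomp Require Import all_boot all_order all_algebra.
From mathcomp Require Import ring boolp.

(** The depth of a whiskered graph is computed exactly: writing [alpha] for the
    largest size of a stable (independent) set of [G],
      [depthE k (whisker G m) = m * (#|G| - alpha)]   for [m > 0],
    and the theorem is read off from this formula.  Below, [E] is the exterior
    algebra on the vertices of the whiskered graph, [J] its edge ideal, and a
    linear form is an element of degree one.

    Upper bound.  If a linear form [a] is regular on a cyclic module and [b] is
    regular modulo [a], then [b] is already regular ([regular_on_adjoin]).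
    Hence every nontrivial linear combination of a regular sequence is regular
    ([regular_seq_comb]), so no such combination lies in a space consisting of
    non-regular forms.  Take [A] stable of size [alpha].
    A linear form that involves no leaf at a vertex outside [A] is never
    regular ([not_regular_on_whisker]): let [A1] be the set of vertices [x] such
    that some leaf at [x] occurs in the form; the monomial [e_Y], where [Y]
    consists of [A1] and of one leaf at each vertex outside [A1], is killed by
    the form modulo [J], but is not a multiple of it modulo [J].  These forms
    are cut out by [m * (#|G| - alpha)] coordinates, which bounds the length of
    a regular sequence.

    Lower bound.  With distinct scalars [c_x] attached to the vertices [x] of
    [G], the forms [sum_x c_x ^+ j *: e_(x, i)], for [j < #|G| - alpha] and
    [i < m], make a regular sequence.  The regularity of the form [l] after the
    forms [p] of an initial segment is witnessed by a contraction operator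
    [Phi] with [Phi (l w) = w - l (Phi w)] and [Phi (p w) = - p (Phi w)] modulo
    [J]: if [l y] lies in the ideal generated by [J] and the [p], so do
    [Phi (l y)] and then [y - l (Phi y)] ([regular_on_contract]).  Contraction
    by one fixed functional does not preserve [J], because it may remove the
    leaf that makes a monomial vanish.  But all these forms live on the leaves,
    so multiplication by them preserves the set [D] of vertices of [G] that
    occur in a monomial, and the functional may be chosen separately for each
    stable [D], supported on the leaves outside [D].  A functional of this kind
    that is dual to the given forms exists because [#|G| - alpha] is at most the
    number of vertices outside [D] and Vandermonde matrices are invertible
    ([vandermonde_dual]). *)

Set Implicit Arguments.
Unset Strict Implicit.
Unset Printing Implicit Defensive.

Import GRing.Theory.
Local Open Scope ring_scope.

(** * Multiplication by linear forms *)

Section Exterior.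
Variables (k : fieldType) (V : finType).
Local Notation E := (extalg k V).
Local Notation e := (@ext_gen k V).
Local Notation eB := (@ext_basis k V).
Local Notation sg v C := ((-1) ^+ ninv [set v] C : k).
Implicit Types (x y w l p : E) (C D : {set V}) (u v t : V).

Lemma ext_basis_sum x : x = \sum_C (x C : k) *: eB C.
Proof.
apply/ffunP => D; rewrite sum_ffunE (bigD1 D) //= big1 => [|C nCD].
  by rewrite !ffunE eqxx addr0 /GRing.scale /= mulr1.
by rewrite !ffunE eq_sym (negPf nCD) scaler0.
Qed.

Lemma ext1_gen v : e v \in ext1 k V.
Proof. by apply/memv_span/codomP; exists v. Qed.

Lemma ext1P l : l \in ext1 k V -> l = \sum_v (l [set v] : k) *: e v.
Proof.
rewrite /ext1 -[codom _]/(tval (in_tuple _)) => /coord_span ->.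
elim/big_ind: _ => [|x y IHx IHy|i _].
- by rewrite big1 // => v _; rewrite ffunE; apply: scale0r.
- rewrite {1}IHx {1}IHy -big_split; apply: eq_bigr => v _.
  by rewrite ffunE; apply/esym/scalerDl.
have /codomP[u ->] := mem_nth 0 (ltn_ord i).
rewrite (bigD1 u) //= big1 ?addr0 => [|v nvu].
  by rewrite !ffunE eqxx /GRing.scale /= mulr1.
by rewrite !ffunE (inj_eq set1_inj) (negPf nvu) scaler0; apply: scale0r.
Qed.

Lemma ext_gen_mul u w C : (e u * w) C =
  if u \in C then sg u (C :\ u) * (w (C :\ u) : k) else 0 :> k.
Proof.
rewrite ffunE; case: ifPn => uC.
  rewrite (bigD1 [set u]) ?sub1set //= ffunE eqxx mulr1 big1 ?addr0 // => D.
  by case/andP=> _ nD; rewrite ffunE (negPf nD) mulr0 mul0r.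
rewrite big1 // => D sDC; rewrite ffunE.
case: eqP => [eD|_]; last by rewrite mulr0 mul0r.
by rewrite eD sub1set (negPf uC) in sDC.
Qed.

Lemma ext1_mul l w C : l \in ext1 k V -> (l * w) C =
  \sum_(t in C) (l [set t] : k) * sg t (C :\ t) * (w (C :\ t) : k) :> k.
Proof.
move=> /ext1P {1}->; rewrite mulr_suml sum_ffunE [RHS]big_mkcond.
apply: eq_bigr => t _; rewrite -scalerAl ffunE ext_gen_mul.
by case: ifP => _; rewrite /GRing.scale /= ?mulr0 ?mulrA.
Qed.

Lemma ext_mul_gen u w C : (w * e u) C =
  if u \in C then (-1) ^+ ninv (C :\ u) [set u] * (w (C :\ u) : k) else 0 :> k.
Proof.
rewrite ffunE; case: ifPn => uC.
  rewrite (bigD1 (C :\ u)) ?subD1set //= big1 ?addr0 => [|D].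
    rewrite ffunE; have -> : C :\: (C :\ u) = [set u].
      by rewrite setDDr setDv set0U; apply/setIidPr; rewrite sub1set.
    by rewrite eqxx mulr1.
  case/andP=> sDC nD; rewrite ffunE; case: eqP => [eD|_]; last by rewrite mulr0.
  case/eqP: nD; rewrite -eD setDDr setDv set0U.
  by apply/esym/setIidPr.
rewrite big1 // => D sDC; rewrite ffunE.
case: eqP => [eD|_]; last by rewrite mulr0.
have : u \in C :\: D by rewrite eD set11.
by rewrite inE (negPf uC) andbF.
Qed.

Lemma ninv1C v C : v \notin C -> (ninv C [set v] + ninv [set v] C)%N = #|C|.
Proof.
move=> vC; rewrite /ninv big_set1 -big_split -[RHS]sum1_card.
apply: eq_bigr => u uC /=; rewrite big_set1.
case: ltngtP => // /val_inj/enum_rank_inj euv.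
by rewrite euv uC in vC.
Qed.

(** The grading involution, which turns right multiplication by a linear form
    into left multiplication ([mul_ext1]). *)
Definition ext_parity x : E :=
  [ffun C : {set V} => (-1) ^+ #|C| * (x C : k) : k^o].

Lemma ext_parityK x : ext_parity (ext_parity x) = x.
Proof. by apply/ffunP => C; rewrite !ffunE mulrA -expr2 sqrr_sign mul1r. Qed.

Lemma mul_ext1 x l : l \in ext1 k V -> x * l = l * ext_parity x.
Proof.
move=> /ext1P ->; rewrite mulr_sumr mulr_suml; apply: eq_bigr => v _.
rewrite -scalerAr -scalerAl; congr (_ *: _); apply/ffunP => C.
rewrite ext_mul_gen ext_gen_mul; case: ifP => // vC.
rewrite ffunE -(@ninv1C v) ?setD11 // exprD mulrA mulrCA -expr2 sqrr_sign.
by rewrite mulr1.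
Qed.

Lemma ext1_mulC l p : l \in ext1 k V -> p \in ext1 k V -> p * l = - (l * p).
Proof.
move=> l1 /ext1P p1; rewrite mul_ext1 // -mulrN; congr (_ * _).
apply/ffunP => C; rewrite !ffunE.
case: (eqVneq #|C| 1%N) => [C1|nC]; first by rewrite C1 expr1 mulN1r.
suff -> : p C = 0 by rewrite mulr0 oppr0.
rewrite p1 sum_ffunE big1 // => v _; rewrite !ffunE.
by case: (C =P [set v]) nC => [->|_]; rewrite ?cards1 ?scaler0.
Qed.

(** Proved by adding up the terms of [l], not from anticommutativity, so that
    it holds in characteristic 2 as well. *)
Lemma ext1_sq l : l \in ext1 k V -> l * l = 0.
Proof.
move=> /ext1P ->.
suff [] : \sum_v (l [set v] : k) *: e v \in ext1 k V /\
  (\sum_v (l [set v] : k) *: e v) * (\sum_v (l [set v] : k) *: e v) = 0 by [].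
elim/big_rec: _ => [|v x _ [x1 xx]]; first by rewrite mem0v mulr0.
have v1 : (l [set v] : k) *: e v \in ext1 k V by rewrite memvZ ?ext1_gen.
rewrite memvD // mulrDl !mulrDr xx (ext1_mulC v1 x1) addr0 addrK.
by rewrite -scalerAl -scalerAr ext_gen_sq !scaler0.
Qed.

End Exterior.

(** * A monomial outside an ideal of linear forms *)

Section Graph.
Variables (k : fieldType) (V : finType).
Local Notation E := (extalg k V).
Local Notation e := (@ext_gen k V).
Local Notation eB := (@ext_basis k V).
Implicit Types (x y w l a : E) (C D : {set V}) (u v t : V).

Lemma mul_prod_ext1 (s : seq E) l : {subset s <= ext1 k V} -> l \in s ->
  \prod_(p <- s) p * l = 0.
Proof.
elim: s => // p s IHs s1; have p1 : p \in ext1 k V by apply/s1/mem_head.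
have s1' : {subset s <= ext1 k V} by move=> q sq; apply: s1; rewrite inE sq orbT.
rewrite inE big_cons -mulrA => /orP[/eqP ->|sl]; last by rewrite IHs ?mulr0.
by rewrite (mul_ext1 _ p1) mulrA ext1_sq // mul0r.
Qed.

(** Such a product generates its two-sided ideal as a left ideal; hence its
    right annihilator is a two-sided ideal. *)
Lemma prod_ext1_normal (s : seq E) a : {subset s <= ext1 k V} ->
  exists a', \prod_(p <- s) p * a = a' * \prod_(p <- s) p.
Proof.
elim: s a => [|p s IHs] a s1; first by exists a; rewrite !big_nil mulr1 mul1r.
have s1' : {subset s <= ext1 k V} by move=> q sq; apply: s1; rewrite inE sq orbT.
have [a' ea] := IHs a s1'; exists (ext_parity a').
have p1 : p \in ext1 k V by apply/s1/mem_head.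
by rewrite !big_cons -mulrA ea [RHS]mulrA (mul_ext1 _ p1) ext_parityK mulrA.
Qed.

Lemma ext_gen_basis v C :
  e v * eB C = if v \in C then 0 else (-1) ^+ ninv [set v] C *: eB (v |: C).
Proof. by rewrite ext_basisM disjoints1; case: (v \in C). Qed.

(** The forms [e_v + c_v e_(f v)], [v \notin Y], eliminate the variables outside
    [Y], so modulo them [E] is the exterior algebra on [Y], whose top monomial
    is [e_Y].  The proof avoids the quotient: the product [z] of these forms
    annihilates the ideal they generate, whereas [z * e_Y] is a nonzero multiple
    of the product of all the variables. *)
Lemma ext_basis_notin_ideal (Y : {set V}) (c : V -> k) (f : V -> V) :
    (forall v, v \notin Y -> f v \in Y) ->
  ~ ideal_gen (fun x => exists2 v, v \notin Y & x = e v + c v *: e (f v))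
      (eB Y).
Proof.
move=> fY; pose g v := e v + c v *: e (f v).
pose z := \prod_(p <- [seq g v | v <- enum (~: Y)]) p.
have g1 : {subset [seq g v | v <- enum (~: Y)] <= ext1 k V}.
  by move=> _ /mapP[v _ ->]; rewrite memvD ?memvZ ?ext1_gen.
have iz : is_ideal (fun x => z * x = 0).
  split=> [|x y zx zy|a x zx|a x zx]; rewrite ?mulr0 //.
  - by rewrite mulrDr zx zy addr0.
  - by have [a' ea] := prod_ext1_normal a g1; rewrite mulrA ea -mulrA zx mulr0.
  - by rewrite mulrA zx mul0r.
move/(_ _ iz) => zY.
have : z * eB Y = 0.
  apply: zY => _ [v vY ->]; apply: mul_prod_ext1 g1 _.
  by apply/mapP; exists v; rewrite ?mem_enum ?inE.
suff gY (s : seq V) : uniq s -> {in s, forall v, v \notin Y} ->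
    exists2 d : k, d != 0 &
      \prod_(p <- [seq g v | v <- s]) p * eB Y = d *: eB (Y :|: [set:: s]).
  have [|v|d d0 ->] := gY (enum (~: Y)); rewrite ?enum_uniq // ?mem_enum ?inE //.
  move=> /eqP; rewrite scaler_eq0 (negPf d0) /= => /eqP/ffunP.
  move/(_ (Y :|: [set:: enum (~: Y)])).
  by rewrite !ffunE eqxx; apply/eqP/oner_neq0.
elim: s => [_ _|v s IHs /= /andP[vs us] sY].
  exists 1; first exact: oner_neq0.
  rewrite big_nil mul1r scale1r; congr ext_basis.
  by apply/setP=> u; rewrite !inE orbF.
have [//|u su|d d0 ed] := IHs; first by apply: sY; rewrite inE su orbT.
have vY : v \notin Y by apply/sY/mem_head.
exists (d * (-1) ^+ ninv [set v] (Y :|: [set:: s])).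
  by rewrite mulf_neq0 // signr_eq0.
(* The term in [e (f v)] vanishes, since [f v] already lies in [Y]. *)
rewrite big_cons -mulrA ed -scalerAr mulrDl -scalerAl !ext_gen_basis !inE.
rewrite (negPf vY) fY // (negPf vs) /= scaler0 addr0 scalerA.
congr (_ *: ext_basis _ _).
by apply/setP=> u; rewrite !inE; case: (u == v); rewrite ?orbT.
Qed.

End Graph.

(** * Linear combinations of regular sequences *)

Section Regular.
Variables (k : fieldType) (V : finType).
Local Notation E := (extalg k V).
Implicit Types (J K : E -> Prop) (x y w a b l : E) (ls : seq E).

Lemma idealZ K (c : k) x : is_ideal K -> K x -> K (c *: x).
Proof. by case=> _ _ KM _ Kx; rewrite -mulr_algl; apply: KM. Qed.

Lemma idealB K x y : is_ideal K -> K x -> K y -> K (x - y).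
Proof. by case=> _ KD KM _ Kx Ky; rewrite -mulN1r; apply/KD/KM. Qed.

Lemma sub_adjoin J ls x : J x -> adjoin_ideal J ls x.
Proof. by move=> Jx; apply: ideal_genS; left. Qed.

Lemma adjoin_nil J x : is_ideal J -> adjoin_ideal J [::] x <-> J x.
Proof. by move=> iJ; split=> [/(_ J iJ)|]; [apply => y [] | exact: sub_adjoin]. Qed.

(** Because [a * l = l * ext_parity a], the right multiples of [l] already form
    a two-sided ideal: adjoining forms one at a time needs no left factors. *)
Lemma adjoin_rcons J ls l x : l \in ext1 k V ->
  adjoin_ideal J (rcons ls l) x <-> exists w, adjoin_ideal J ls (x - l * w).
Proof.
move=> l1; have [K0 KD KM KMr] := is_ideal_gen (fun y : E => J y \/ y \in ls).
split=> [|[w Kw]].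
  move/(_ (fun y => exists w, adjoin_ideal J ls (y - l * w))).
  apply=> [|y]; last first.
    rewrite mem_rcons inE => -[Jy|/orP[/eqP ->|lsy]].
    - by exists 0; rewrite mulr0 subr0; apply: sub_adjoin.
    - by exists 1; rewrite mulr1 subrr.
    by exists 0; rewrite mulr0 subr0; apply: ideal_genS; right.
  split=> [|y z [w Ky] [w' Kz]|a y [w Ky]|a y [w Ky]].
  - by exists 0; rewrite mulr0 subr0.
  - exists (w + w'); rewrite mulrDr opprD addrACA; exact: KD.
  - exists (ext_parity a * w); rewrite mulrA -mul_ext1 // -mulrA -mulrBr.
    exact: KM.
  - by exists (w * a); rewrite mulrA -mulrBl; apply: KMr.
have [_ RD _ RMr] := is_ideal_gen (fun y : E => J y \/ y \in rcons ls l).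
rewrite -(subrK (l * w) x); apply: RD; last first.
  by apply: RMr; apply: ideal_genS; right; rewrite mem_rcons mem_head.
apply: Kw; first exact: is_ideal_gen.
move=> y [Jy|lsy]; apply: ideal_genS; [by left|right].
by rewrite mem_rcons inE lsy orbT.
Qed.

Lemma eq_regular_on J K l : (forall x, J x <-> K x) ->
  regular_on J l -> regular_on K l.
Proof.
move=> eJK reg y; rewrite -eJK reg.
by split=> -[z /eJK Jz]; exists z.
Qed.

Lemma regular_on_addZ K l x (c : k) : is_ideal K -> K x -> c != 0 ->
  regular_on K l -> regular_on K (x + c *: l).
Proof.
move=> iK Kx c0 reg y; have [_ KD KM KMr] := iK; split=> [Kxy|[z Kz]].
  have /reg[z Kz] : K (l * y).
    have -> : l * y = c^-1 *: ((x + c *: l) * y - x * y).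
      by rewrite mulrDl addrAC subrr add0r -scalerAl scalerA mulVf // scale1r.
    by apply: idealZ => //; apply: idealB => //; apply: KMr.
  exists (c^-1 *: z).
  have -> : y - (x + c *: l) * (c^-1 *: z) = y - l * z - x * (c^-1 *: z).
    rewrite mulrDl -scalerAl -[l * (_ *: _)]scalerAr scalerA mulfV // scale1r.
    by rewrite opprD addrA addrAC.
  by apply: idealB => //; apply: KMr.
rewrite mulrDl -scalerAl; apply: (KD); first exact: KMr.
apply: idealZ => //; apply/reg; exists (c *: z).
have -> : y - l * (c *: z) = (y - (x + c *: l) * z) + x * z.
  by rewrite mulrDl -scalerAl -[l * (_ *: _)]scalerAr opprD addrA addrAC subrK.
by apply: KD => //; apply: KMr.
Qed.

(** If [b y = 0] modulo [K], regularity modulo [a] gives [y = b z + a w].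
    Multiplying by [b] shows that [b w] is killed by [a], hence a multiple of
    [a]; so [w = b v + a t], and [y = b (z - a v)] since [a a = 0]. *)
Lemma regular_on_adjoin K a b : is_ideal K ->
    a \in ext1 k V -> b \in ext1 k V -> regular_on K a ->
    regular_on (fun x => exists w, K (x - a * w)) b ->
  regular_on K b.
Proof.
move=> iK a1 b1 rega regb y; have [K0 KD KM KMr] := iK.
split=> [Kby|[z Kz]]; last first.
  have -> : b * y = b * (y - b * z) by rewrite mulrBr mulrA ext1_sq // mul0r subr0.
  exact: KM.
have KN x : K x -> K (- x) by move=> /(KM (-1)); rewrite mulN1r.
have /regb[z [w Kw]] : exists w, K (b * y - a * w) by exists 0; rewrite mulr0 subr0.
have /rega[u Ku] : K (a * (b * w)).
  have -> : a * (b * w) = b * (y - b * z - a * w) - b * y.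
    rewrite !mulrBr !mulrA ext1_sq // mul0r (ext1_mulC a1 b1) subr0 mulNr opprK.
    by rewrite addrC addKr.
  by apply: KD; [apply: KM | apply: KN].
have /regb[v [t Kt]] : exists w', K (b * w - a * w') by exists u.
exists (z - a * v).
have -> : y - b * (z - a * v) =
    (y - b * z - a * w) + a * (w - b * v - a * t).
  rewrite !mulrBr !mulrA ext1_sq // mul0r subr0 (ext1_mulC a1 b1) mulNr opprK.
  by rewrite addrA subrK opprD addrA.
by apply: KD => //; apply: KM.
Qed.

(** Let [j] be the last index with a nonzero coefficient.  Modulo the forms
    before [j], the combination is a nonzero multiple of [ls`_j], hence regular;
    [regular_on_adjoin] then removes these forms from the last to the first. *)
Lemma regular_seq_comb J ls (c : nat -> k) : is_ideal J -> regular_seq J ls ->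
    (exists2 i, (i < size ls)%N & c i != 0) ->
  regular_on J (\sum_(i < size ls) c i *: ls`_i).
Proof.
move=> iJ [ls1 reg] [i0 lt_i0 ci0].
set v := \sum_(i < _) _.
have iK i : is_ideal (adjoin_ideal J (take i ls)) by apply: is_ideal_gen.
have v1 : v \in ext1 k V.
  by apply: memv_suml => i _; apply/memvZ/ls1/mem_nth.
have [j /andP[lt_j cj] j_max] :
    {j | (j < size ls)%N && (c j != 0) &
         forall i, (i < size ls)%N && (c i != 0) -> (i <= j)%N}.
  have exP : exists i, (i < size ls)%N && (c i != 0) by exists i0; rewrite lt_i0.
  have bP i : (i < size ls)%N && (c i != 0) -> (i <= size ls)%N.
    by case/andP=> /ltnW.
  by case: (ex_maxnP exP bP) => j; exists j.
suff regK d : (d <= j)%N -> regular_on (adjoin_ideal J (take (j - d) ls)) v.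
  apply: eq_regular_on (regK j (leqnn j)) => x.
  by rewrite subnn take0; apply: adjoin_nil.
elim: d => [_|d IHd lt_dj].
  have -> : v = (\sum_(i < size ls | i != j :> nat) c i *: ls`_i) + c j *: ls`_j.
    by rewrite /v (bigD1 (Ordinal lt_j)) //= addrC.
  rewrite subn0; apply: regular_on_addZ => //; last exact: reg.
  have [K0 KD KM _] := iK j.
  elim/big_ind: _ => // i ne_ij; case: (eqVneq (c i) 0) => [->|ci].
    by rewrite scale0r.
  apply: (idealZ _ (iK j)); apply: ideal_genS; right.
  have lt_ij : (i < j)%N by rewrite ltn_neqAle ne_ij j_max // ltn_ord.
  by rewrite -(nth_take 0 lt_ij) mem_nth // size_take lt_j.
set i := (j - d.+1)%N.
have ei : (j - d = i.+1)%N by rewrite /i subnS prednK ?subn_gt0.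
have lt_i : (i < size ls)%N by apply: leq_ltn_trans lt_j; apply: leq_subr.
have li1 : ls`_i \in ext1 k V by apply/ls1/mem_nth.
apply: (regular_on_adjoin (iK i) li1 v1); first exact: reg.
apply: eq_regular_on (IHd (ltnW lt_dj)) => x.
by rewrite ei (take_nth 0) //; apply: adjoin_rcons.
Qed.

(** A sequence longer than [#|O|] would have a nontrivial combination whose
    coordinates on [O] vanish, although it is regular by [regular_seq_comb]. *)
Lemma regular_seq_leq J ls (O : {set V}) : is_ideal J -> regular_seq J ls ->
    (forall l, l \in ext1 k V -> (forall v, v \in O -> l [set v] = 0 :> k) ->
       ~ regular_on J l) ->
  (size ls <= #|O|)%N.
Proof.
move=> iJ rls nreg; have ls1 := rls.1; rewrite leqNgt; apply/negP => ltO.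
pose P : 'M[k]_(size ls, #|O|) := \matrix_(i, j) (ls`_i [set enum_val j] : k).
have /rowV0Pn[c /sub_kermxP cP0 c0] : kermx P != 0.
  rewrite kermx_eq0 -row_leq_rank -ltnNge; apply: leq_ltn_trans ltO.
  exact: rank_leq_col.
pose d n := if insub n is Some i then c 0 i else 0.
have dE (i : 'I_(size ls)) : d i = c 0 i by rewrite /d valK.
apply: (nreg (\sum_(i < size ls) d i *: ls`_i)).
- by apply: memv_suml => i _; apply/memvZ/ls1/mem_nth.
- move=> v vO; have /rowP/(_ (enum_rank_in vO v)) := cP0.
  rewrite !mxE => <-; rewrite sum_ffunE; apply: eq_bigr => i _.
  by rewrite ffunE dE mxE enum_rankK_in.
apply: regular_seq_comb => //; case/rV0Pn: c0 => i ci.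
by exists i; rewrite ?dE.
Qed.

End Regular.

(** * Contractions by a varying functional *)

Section Contract.
Variables (k : fieldType) (V : finType).
Local Notation E := (extalg k V).
Local Notation sg v C := ((-1) ^+ ninv [set v] C : k).
Implicit Types (x y w l a : E) (C D : {set V}) (u v t : V).
Implicit Types (phi : {set V} -> V -> k).

(** Interior product by a linear functional [phi C] which may vary with the
    monomial [C] whose coordinate is being computed. *)
Definition contract phi y : E :=
  [ffun C : {set V} =>
    (\sum_(v | v \notin C) phi C v * sg v C * (y (v |: C) : k) : k) : k^o].

Lemma contractB phi x y : contract phi (x - y) = contract phi x - contract phi y.
Proof.
apply/ffunP => C; rewrite !ffunE -sumrB; apply: eq_bigr => v _.
by rewrite !ffunE mulrBr.
Qed.

Lemma sg_swap u v : u != v -> sg u [set v] * sg v [set u] = -1.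
Proof.
move=> nuv; rewrite -exprD /ninv !big_set1.
case: ltngtP => [||/val_inj/enum_rank_inj euv]; rewrite ?expr1 //.
by rewrite euv eqxx in nuv.
Qed.

(** The Leibniz rule [phi (l w) = phi(l) w - l (phi w)].  It survives for a
    varying functional as soon as [phi] does not see the variables of [l]: on
    the right, [phi] is evaluated at [C :\ t] for those [t] that occur in [l]. *)
Lemma contract_mul phi l w C : l \in ext1 k V ->
    (forall t, t \in C -> l [set t] != 0 :> k -> phi (C :\ t) = phi C) ->
  contract phi (l * w) C =
    (\sum_v phi C v * (l [set v] : k)) * (w C : k) - (l * contract phi w) C :> k.
Proof.
move=> l1 phiC; rewrite ext1_mul // ffunE.
(* The contribution of contracting [v] and multiplying by [e_t], [v != t]. *)
pose F v t := phi C v * sg v C *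
  ((l [set t] : k) * sg t ((v |: C) :\ t) * (w ((v |: C) :\ t) : k)).
have -> : \sum_(v | v \notin C) phi C v * sg v C * ((l * w) (v |: C) : k) =
    (\sum_(v | v \notin C) phi C v * (l [set v] : k)) * (w C : k) +
    \sum_(v | v \notin C) \sum_(t in C) F v t.
  rewrite mulr_suml -big_split; apply: eq_bigr => v vC /=.
  rewrite ext1_mul // big_setU1 //= mulrDr -mulr_sumr; congr (_ + _).
  rewrite setU1K // mulrA; congr (_ * _); rewrite mulrACA -expr2 sqrr_sign.
  by rewrite mulr1.
have -> : \sum_(t in C)
      (l [set t] : k) * sg t (C :\ t) * (contract phi w (C :\ t) : k) =
    (\sum_(t in C) phi C t * (l [set t] : k)) * (w C : k) -
    \sum_(t in C) \sum_(v | v \notin C) F v t.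
  rewrite mulr_suml -sumrB; apply: eq_bigr => t tC.
  have [lt0|lt] := eqVneq (l [set t] : k) 0.
    rewrite lt0 !(mul0r, mulr0) big1 ?subr0 // => v _.
    by rewrite /F lt0 !(mul0r, mulr0).
  rewrite ffunE (bigD1 t) ?setD11 //= phiC // setD1K // mulrDr; congr (_ + _).
    have := sqrr_sign k (ninv [set t] (C :\ t)); rewrite expr2 => ss.
    set a := sg t (C :\ t) in ss *.
    transitivity (a * a * (phi C t * (l [set t] : k) * (w C : k))); first by ring.
    by rewrite ss mul1r.
  rewrite mulr_sumr -sumrN; apply: eq_big => [v|v /andP[vC vt]].
    by rewrite !inE negb_and negbK; case: eqP => [->|]; rewrite ?tC ?andbT.
  have eC : (v |: C) :\ t = v |: (C :\ t).
    apply/setP=> u; rewrite !inE; case: (u =P t) => // ->.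
    by rewrite eq_sym (negPf vt).
  have -> : F v t = sg v [set t] * sg t [set v] * ((l [set t] : k) * sg t (C :\ t) *
      (phi C v * sg v (C :\ t) * (w (v |: C :\ t) : k))).
    have eS : sg v C = sg v [set t] * sg v (C :\ t).
      by rewrite -exprD -ninvUr ?disjoints1 ?setD11 // setD1K.
    rewrite /F eC eS (@ninvUr _ [set t]) ?disjoints1 // exprD.
    by ring.
  by rewrite sg_swap // mulN1r opprK.
rewrite exchange_big /=. 
rewrite [\sum_v _](bigID [in C]) /=.
by ring.
Qed.

End Contract.

(** * Edge ideals and a criterion for regularity *)

Section EdgeIdeal.
Variables (k : fieldType) (H : sgraph).
Local Notation E := (extalg k H).
Implicit Types (C : {set H}).

Definition stable C := [forall u in C, forall v in C, ~~ sedge u v].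

Lemma stableP C : reflect {in C &, forall u v, ~~ sedge u v} (stable C).
Proof.
apply: (iffP forall_inP) => [sC u v uC vC|sC u uC].
  exact: (forall_inP (sC u uC)).
by apply/forall_inP => v; apply: sC.
Qed.

(** The ideal is spanned by the monomials that contain both ends of an edge, so
    the monomials on stable sets form a basis of the quotient. *)
Lemma edge_idealP (x : E) :
  edge_ideal x <-> forall C, stable C -> x C = 0 :> k.
Proof.
split=> [|x0].
  move/(_ (fun x => forall C, stable C -> x C = 0 :> k)); apply.
    have sub (C D : {set H}) : C \subset D -> stable D -> stable C.
      move=> sCD /stableP sD; apply/stableP => u v uC vC.
      by apply: sD; apply: (subsetP sCD).
    split=> [C _|x' y x0 y0 C sC|a x' x0 C sC|a x' x0 C sC]; rewrite ffunE //.
    - by rewrite x0 // y0 // addr0.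
    - by apply: big1 => D _; rewrite (x0 _ (sub _ _ (subsetDl _ _) sC)) mulr0.
    - by apply: big1 => D sD; rewrite (x0 _ (sub _ _ sD sC)) mulr0 mul0r.
  move=> _ [u [v [euv ->]]] C /stableP sC; rewrite ext_gen_mul.
  case: ifP => // uC; rewrite ffunE; case: eqP => [eC|_]; last by rewrite mulr0.
  have vC : v \in C :\ u by rewrite eC set11.
  by case/negP: (sC u v uC (subsetP (subD1set _ _) _ vC)).
rewrite (ext_basis_sum x); have iJ := is_ideal_gen (fun x => exists u v : H,
  sedge u v /\ x = ext_gen k u * ext_gen k v).
have [J0 JD JM JMr] := iJ.
elim/big_ind: _ => // C _; have [/x0 ->|nsC] := boolP (stable C).
  by have -> : (0 : k) *: ext_basis k C = 0 by exact: scale0r.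
apply: (idealZ _ iJ).
have [u uC [v vC euv]] : exists2 u, u \in C & exists2 v, v \in C & sedge u v.
  case/forall_inPn: nsC => u uC /forall_inPn[v vC]; rewrite negbK => euv.
  by exists u => //; exists v.
have nuv : u != v by apply: contraL euv => /eqP ->; rewrite sedge_irrefl.
have : edge_ideal (ext_gen k u * ext_gen k v * ext_basis k (C :\ u :\ v)).
  by apply: JMr; apply: ideal_genS; exists u, v.
rewrite -mulrA !ext_gen_basis !inE eqxx /= setD1K; last by rewrite !inE eq_sym nuv.
rewrite -scalerAr ext_gen_basis setD11 setD1K // scalerA -exprD.
move/(idealZ ((-1) ^+ (ninv [set v] (C :\ u :\ v) + ninv [set u] (C :\ u))) iJ).
by rewrite scalerA -expr2 sqrr_sign scale1r.
Qed.

(** The contraction by [phi] is a contracting homotopy for the multiplication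
    by [l] modulo the edge ideal and [ls].  The condition on stable sets makes
    it preserve the edge ideal; local constancy of [phi] along the variables of
    the forms gives the Leibniz rule; the two sums say that the functionals
    vanish on [ls] and take the value 1 on [l]. *)
Lemma regular_on_contract (ls : seq E) (l : E) (phi : {set H} -> H -> k) :
    {subset l :: ls <= ext1 k H} ->
    (forall C v, stable C -> v \notin C -> phi C v != 0 -> stable (v |: C)) ->
    (forall C p t, stable C -> p \in l :: ls -> t \in C -> p [set t] != 0 :> k ->
       phi (C :\ t) = phi C) ->
    (forall C p, stable C -> p \in ls -> \sum_v phi C v * (p [set v] : k) = 0) ->
    (forall C, stable C -> \sum_v phi C v * (l [set v] : k) = 1) ->
  regular_on (adjoin_ideal (@edge_ideal k H) ls) l.
Proof.
move=> ls1 phi_st phi_loc phi0 phi1.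
have l1 : l \in ext1 k H by apply/ls1/mem_head.
have iJ : is_ideal (@edge_ideal k H) by apply: is_ideal_gen.
have contractJ x : edge_ideal x -> edge_ideal (contract phi x).
  move/edge_idealP => x0; apply/edge_idealP => C sC; rewrite ffunE.
  apply: big1 => v vC.
  have [->|/phi_st sv] := eqVneq (phi C v) 0.
    by rewrite !mul0r.
  by rewrite x0 ?mulr0 ?sv.
have contract_ls p w : p \in ls ->
    edge_ideal (contract phi (p * w) + p * contract phi w).
  move=> lsp; apply/edge_idealP => C sC; rewrite ffunE contract_mul.
  - by rewrite phi0 // mul0r sub0r addNr.
  - by apply: ls1; rewrite inE lsp orbT.
  by move=> t tC pt; apply: phi_loc pt; rewrite ?inE ?lsp ?orbT.
have contract_l w : edge_ideal (contract phi (l * w) - (w - l * contract phi w)).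
  apply/edge_idealP => C sC; rewrite ffunE contract_mul //.
    by rewrite phi1 // mul1r; move: (l * _) => q; rewrite !ffunE subrr.
  by move=> t tC lt; apply: phi_loc lt; rewrite ?mem_head.
have contractK : forall x, adjoin_ideal (@edge_ideal k H) ls x ->
    adjoin_ideal (@edge_ideal k H) ls (contract phi x).
  have : {subset ls <= ls} by [].
  elim/last_ind: {1 3 4}ls => [_ x|s p IHs sls x].
    by rewrite !adjoin_nil //; apply: contractJ.
  have lsp : p \in ls by apply: sls; rewrite mem_rcons mem_head.
  have p1 : p \in ext1 k H by apply: ls1; rewrite inE lsp orbT.
  rewrite !adjoin_rcons // => -[w].
  move/IHs; rewrite contractB => Kx; exists (- contract phi w).
  have -> : contract phi x - p * - contract phi w = contract phi x -
      contract phi (p * w) + (contract phi (p * w) + p * contract phi w).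
    by rewrite mulrN opprK addrA subrK.
  have [_ KD _ _] := is_ideal_gen (fun y : E => edge_ideal y \/ y \in s).
  apply: KD; last by apply: sub_adjoin; apply: contract_ls.
  by apply: Kx => q sq; apply: sls; rewrite mem_rcons inE sq orbT.
have iK : is_ideal (adjoin_ideal (@edge_ideal k H) ls) by apply: is_ideal_gen.
move=> y; split=> [/contractK Ky|[z Kz]].
  exists (contract phi y); rewrite -[y - _](subKr (contract phi (l * y))).
  by apply: (idealB iK) => //; apply: sub_adjoin; apply: contract_l.
have -> : l * y = l * (y - l * z) by rewrite mulrBr mulrA ext1_sq // mul0r subr0.
by case: iK => _ _ KM _; apply: KM.
Qed.

End EdgeIdeal.

Section EdgeBasis.
Variables (k : fieldType) (H : sgraph).

Lemma edge_ideal_gen_basis (u v : H) (C : {set H}) : sedge u v -> v \in C ->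
  edge_ideal (ext_gen k u * ext_basis k C).
Proof.
move=> euv vC; rewrite ext_gen_basis.
have iJ : is_ideal (@edge_ideal k H) by apply: is_ideal_gen.
case: ifP => _; first by case: iJ.
apply: (idealZ _ iJ); apply/edge_idealP => D /stableP sD; rewrite ffunE.
case: eqP => // eD; have := sD u v; rewrite eD !inE eqxx vC orbT euv.
by move=> /(_ isT isT).
Qed.
End EdgeBasis.

(** * Whiskered graphs: the upper bound *)

Section Whisker.
Variables (k : fieldType) (G : sgraph) (m : nat).
Local Notation W := (whisker G m).
Local Notation E := (extalg k W).
Local Notation e := (@ext_gen k W).
Local Notation J := (@edge_ideal k W).
Local Notation root x := (inl x : W).
Local Notation leaf x i := (inr (x, i) : W).

Lemma sum_whisker (R : nmodType) (F : W -> R) :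
  \sum_v F v = \sum_x F (root x) + \sum_x \sum_i F (leaf x i).
Proof.
have -> : \sum_v F v = \sum_(v : (G + G * 'I_m)%type) F v by [].
rewrite big_sumType pair_bigA /=; congr (_ + _).
by apply: eq_bigr => -[x i].
Qed.

(** The witness is the monomial [e_Y], where [Y] consists of the set [A1] of
    vertices with a leaf occurring in [l], and of one leaf at each other vertex
    of [G].  It is killed by [l] modulo [J]: each variable of [l] is in [Y] or adjacent to a vertex of [Y].
    It is not a multiple of [l] modulo [J], because [l] and [J] both lie in an
    ideal of the kind treated in [ext_basis_notin_ideal]: all variables outside
    [Y] are set to zero, except that for [x] in [A1] the part of [l] in the
    variable of [x] and one chosen leaf at [x] is set to zero instead.  This
    identifies the leaf variable with a multiple of the variable of [x], which
    kills their product.  Edges inside [A1] do not occur as [A] is stable. *)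
Lemma not_regular_on_whisker (A : {set G}) (l : E) : (0 < m)%N -> stable A ->
    l \in ext1 k W -> (forall x i, x \notin A -> l [set leaf x i] = 0 :> k) ->
  ~ regular_on J l.
Proof.
move=> m0 /stableP sA l1 l0 regl; pose i0 := Ordinal m0.
pose lc v : k := l [set v].
pose A1 := [set x | [exists i, lc (leaf x i) != 0]].
have notA1 x i : x \notin A1 -> lc (leaf x i) = 0.
  by rewrite inE => /existsPn/(_ i); rewrite negbK => /eqP.
have A1A x : x \in A1 -> x \in A.
  by rewrite inE => /existsP[i]; apply: contraNT => /l0 xA; apply/eqP/xA.
pose pk x := odflt i0 [pick i | lc (leaf x i) != 0].
have pkP x : x \in A1 -> lc (leaf x (pk x)) != 0.
  rewrite inE => /existsP[i li]; rewrite /pk.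
  by case: pickP => [//|/(_ i)]; rewrite li.
pose Y : {set W} := [set w | match w with
  | inl x => x \in A1 | inr (x, i) => (x \notin A1) && (i == i0) end].
(* For [x] in [A1] with chosen leaf [i], the generator at [leaf x i] is the part
   of [l] on [root x] and [leaf x i], divided by its leaf coefficient. *)
pose c (w : W) : k := if w is inr (x, i) then
  if (x \in A1) && (i == pk x) then lc (root x) / lc (leaf x i) else 0 else 0.
pose f (w : W) : W := let x := match w with inl x => x | inr (x, _) => x end in
  if x \in A1 then root x else leaf x i0.
have fY v : v \notin Y -> f v \in Y.
  by move=> _; rewrite /f; case: ifP => xA1; rewrite inE ?xA1 ?eqxx.
apply: (ext_basis_notin_ideal (c := c) fY).
set I := ideal_gen _.
have iI : is_ideal I by apply: is_ideal_gen.
have [I0 ID IM IMr] := iI.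
have Iroot x : x \notin A1 -> I (e (root x)).
  move=> xA1; apply: ideal_genS; exists (root x); first by rewrite inE.
  by rewrite scale0r addr0.
have Ileaf x i : x \in A1 -> I (e (leaf x i) + c (leaf x i) *: e (root x)).
  move=> xA1; apply: ideal_genS; exists (leaf x i); first by rewrite inE xA1.
  by rewrite /f xA1.
have JI y : J y -> I y.
  apply=> // _ [u [v [euv ->]]].
  case: u v euv => [x|[x i]] [y'|[y' j]] //= euv.
  - have [xA1|/Iroot] := boolP (x \in A1); last exact: IMr.
    have [yA1|/Iroot] := boolP (y' \in A1); last exact: IM.
    by case/negP: (sA _ _ (A1A _ xA1) (A1A _ yA1)).
  - rewrite -(eqP euv); have [xA1|/Iroot] := boolP (x \in A1); last exact: IMr.
    have := IM (e (root x)) _ (Ileaf x j xA1).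
    by rewrite mulrDr -scalerAr ext_gen_sq scaler0 addr0.
  - rewrite -(eqP euv); have [xA1|/Iroot] := boolP (x \in A1); last exact: IM.
    have := IMr (e (root x)) _ (Ileaf x i xA1).
    by rewrite mulrDl -scalerAl ext_gen_sq scaler0 addr0.
have Il : I l.
  rewrite (ext1P l1) sum_whisker -big_split /=.
  elim/big_ind: _ => // x _; have [xA1|xA1] := boolP (x \in A1); last first.
    rewrite big1 ?addr0 => [|i _]; first by apply: (idealZ _ iI); apply: Iroot.
    by have := notA1 x i xA1; rewrite /lc => ->; apply: scale0r.
  rewrite (bigD1 (pk x)) //= addrA; apply: (ID).
    have := idealZ (lc (leaf x (pk x))) iI (Ileaf x (pk x) xA1).
    rewrite scalerDr scalerA /c xA1 eqxx mulrCA mulfV ?pkP // mulr1.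
    by rewrite addrC.
  elim/big_ind: _ => // i ni; apply: (idealZ _ iI).
  by have := Ileaf x i xA1; rewrite /c xA1 (negPf ni) scale0r addr0.
have /regl[z /JI] : J (l * ext_basis k Y).
  have iJ : is_ideal J by apply: is_ideal_gen.
  rewrite (ext1P l1) mulr_suml; have [J0 JD _ _] := iJ.
  elim/big_ind: _ => // v _; rewrite -scalerAl.
  have [lv|lv] := eqVneq (lc v) 0.
    have -> : l [set v] = 0 by [].
    by have -> : (0 : k) *: (e v * ext_basis k Y) = 0 by exact: scale0r.
  apply: (idealZ _ iJ); case: v lv => [x|[x i]] lv.
    have [xA1|xA1] := boolP (x \in A1).
      by rewrite ext_gen_basis inE xA1.
    apply: (@edge_ideal_gen_basis _ W _ (leaf x i0)); first exact: eqxx.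
    by rewrite inE xA1 eqxx.
  have xA1 : x \in A1 by apply: contraNT lv => /notA1 ->.
  apply: (@edge_ideal_gen_basis _ W _ (root x)); first exact: eqxx.
  by rewrite inE.
move=> Iz; rewrite -(subrK (l * z) (ext_basis k Y)); apply: ID => //.
exact: IMr.
Qed.

Lemma depth_whisker_leq (A : {set G}) : (0 < m)%N -> stable A ->
  (depthE k W <= #|~: A| * m)%N.
Proof.
move=> m0 sA; have [[ls [rls <-]] _] := depthEP k W.
pose O : {set W} := [set leaf p.1 p.2 | p in setX (~: A) [set: 'I_m]].
have -> : (#|~: A| * m)%N = #|O|.
  rewrite card_imset => [|[x i] [y j] [-> ->] //].
  by rewrite cardsX cardsT card_ord.
apply: regular_seq_leq rls _; first exact: is_ideal_gen.
move=> l l1 l0; apply: not_regular_on_whisker l1 _; [by []|exact: sA|].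
move=> x i xA; apply: l0; apply/imsetP; exists (x, i) => //.
by rewrite !inE xA.
Qed.

End Whisker.

(** * Whiskered graphs: the lower bound *)

Section Lower.
Variables (k : fieldType).
Hypothesis k0 : [pchar k] =i pred0.

Lemma pchar0_natr_inj : injective (fun n : nat => n%:R : k).
Proof.
have le i j : i%:R = j%:R :> k -> (i <= j)%N.
  move=> eij; rewrite leqNgt; apply/negP => lt_ji.
  have /pcharf0P/(_ (i - j)%N) := k0.
  by rewrite natrB ?(ltnW lt_ji) // eij subrr eqxx subn_eq0 leqNgt lt_ji.
by move=> i j eij; apply/eqP; rewrite eqn_leq !le.
Qed.

(** Inverting the Vandermonde matrix on [r] points of [S] gives the functional
    on polynomials of degree less than [r] that extracts the coefficient of
    degree [j] from the values on [S]. *)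
Lemma vandermonde_dual (T : finType) (c : T -> k) (S : {set T}) r (j : 'I_r) :
    injective c -> (r <= #|S|)%N ->
  exists q : T -> k, (forall x, x \notin S -> q x = 0) /\
    forall j' : 'I_r, \sum_x q x * c x ^+ j' = (j == j')%:R.
Proof.
move=> c_inj leS; pose s (i : 'I_r) : T := enum_val (widen_ord leS i).
have s_inj : injective s by move=> i1 i2 /enum_val_inj/(congr1 val) /= /val_inj.
pose M := Vandermonde r (\row_i c (s i)).
have uM : M \in unitmx.
  rewrite unitmxE det_Vandermonde unitfE; apply/prodf_neq0 => i1 _.
  apply/prodf_neq0 => i2 lt12; rewrite !mxE subr_eq0.
  apply: contraTneq lt12 => /c_inj/s_inj ->; by rewrite ltnn.
exists (fun x => \sum_(i | s i == x) invmx M i j); split=> [x xS|j'].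
  by apply: big_pred0 => i; apply: contraNF xS => /eqP <-; apply: enum_valP.
have /matrixP/(_ j' j) := mulmxV uM; rewrite !mxE eq_sym => <-.
under eq_bigr do rewrite mulr_suml.
rewrite (exchange_big_dep predT) //=; apply: eq_bigr => i _.
by rewrite (big_pred1 (s i)) => [|x]; rewrite ?mxE 1?mulrC // eq_sym.
Qed.

Variables (G : sgraph) (m : nat).
Local Notation W := (whisker G m).
Local Notation E := (extalg k W).
Local Notation e := (@ext_gen k W).
Local Notation J := (@edge_ideal k W).
Local Notation root x := (inl x : W).
Local Notation leaf x i := (inr (x, i) : W).

(** The regular sequence is indexed by ['I_r * 'I_m] in any order: [phi_L] gives
    functionals dual to the whole family at once. *)
Lemma depth_whisker_geq r : (forall D : {set G}, stable D -> (r <= #|~: D|)%N) ->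
  (r * m <= depthE k W)%N.
Proof.
move=> r_le; pose c (x : G) : k := (enum_rank x)%:R.
have leaf_eqE (x y : G) (i j : 'I_m) :
    (leaf x i == leaf y j) = (x == y) && (i == j) by [].
have c_inj : injective c.
  by move=> x y /pchar0_natr_inj/val_inj/enum_rank_inj.
pose L (p : 'I_r * 'I_m) : E := \sum_x c x ^+ p.1 *: e (leaf x p.2).
have L1 p : L p \in ext1 k W by apply: memv_suml => x _; rewrite memvZ ?ext1_gen.
have Lroot p x : L p [set root x] = 0 :> k.
  rewrite sum_ffunE big1 // => y _; rewrite !ffunE (inj_eq set1_inj).
  exact: mulr0.
have Lleaf p x i : L p [set leaf x i] = (c x ^+ p.1 *+ (p.2 == i)) :> k.
  rewrite sum_ffunE (bigD1 x) //= big1 => [|y nyx];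
    rewrite !ffunE (inj_eq set1_inj).
    by rewrite addr0 -[RHS]mulr_natr leaf_eqE eqxx eq_sym.
  by rewrite leaf_eqE eq_sym (negPf nyx); apply: mulr0.
pose base (C : {set W}) : {set G} := [set x | root x \in C].
have sbase C : stable C -> stable (base C).
  move/stableP => sC; apply/stableP => x y; rewrite !inE => xC yC.
  exact: (sC (root x) (root y)).
pose ls := [seq L p | p <- enum {: 'I_r * 'I_m}].
have <- : size ls = (r * m)%N by rewrite size_map -cardE card_prod !card_ord.
apply: (depthEP k W).2; split=> [_ /mapP[p _ ->] //|n].
rewrite size_map => lt_n; have [p0 _] : exists p : 'I_r * 'I_m, true.
  by case: (enum _) lt_n => // p; exists p.
rewrite (nth_map p0) // -map_take; set p := nth _ _ _.
have p_new p' : p' \in take n (enum {: 'I_r * 'I_m}) -> p != p'.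
  move=> p'_in; apply: contraTneq p'_in => <-.
  have := enum_uniq {: 'I_r * 'I_m}; rewrite -{1}(cat_take_drop n (enum _)).
  rewrite (drop_nth p0) // -/p cat_uniq => /and3P[_ + _].
  by case/norP.
have [q qP] : exists q : {set G} -> G -> k, forall D, stable D ->
    (forall x, x \in D -> q D x = 0) /\
    forall j : 'I_r, \sum_x q D x * c x ^+ j = (p.1 == j)%:R.
  apply: (fin_all_exists (U := fun=> G -> k) (P := fun D q => stable D ->
    (forall x, x \in D -> q x = 0) /\
    forall j : 'I_r, \sum_x q x * c x ^+ j = (p.1 == j)%:R)) => D.
  have [sD|] := boolP (stable D); last by exists (fun=> 0).
  have [q [q0 q1]] := vandermonde_dual p.1 c_inj (r_le D sD).
  by exists q => _; split=> // x xD; apply: q0; rewrite inE xD.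
(* As [q D] vanishes on [D], the only neighbour of a leaf [v] with [phi C v != 0]
   is not in [C]: stability passes from [C] to [v |: C]. *)
pose phi (C : {set W}) (v : W) : k :=
  if v is inr (x, i) then q (base C) x *+ (i == p.2) else 0.
have phi_L C p' : stable C ->
    \sum_v phi C v * (L p' [set v] : k) = (p == p')%:R.
  move=> /sbase sC; rewrite sum_whisker big1 => [|x _]; last by rewrite mul0r.
  rewrite add0r exchange_big (bigD1 p.2) //= [X in _ + X]big1 ?addr0 => [|i ni].
    under eq_bigr do rewrite eqxx mulr1n Lleaf mulrnAr.
    rewrite sumrMnl (qP _ sC).2 -mulrnA mulnb [p == p']/eq_op /=.
    by rewrite [p'.2 == _]eq_sym.
  by apply: big1 => x _; rewrite (negPf ni) mulr0n mul0r.
apply: (regular_on_contract (phi := phi)).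
- by move=> l; rewrite inE => /orP[/eqP -> //|/mapP[p' _ ->]].
- move=> C [x|[x i]] sC; rewrite /= ?eqxx // => vC.
  case: (i =P p.2) => [_|]; last by rewrite mulr0n eqxx.
  have [xC|xC _] := boolP (x \in base C).
    by rewrite (qP _ (sbase C sC)).1 // mul0rn eqxx.
  have rC : root x \notin C by rewrite inE in xC.
  apply/stableP => u v; move/stableP: sC => sC.
  rewrite !inE => /orP[/eqP ->|uC] /orP[/eqP ->|vC'] //.
  - by case: v vC' => // y yC; apply: contraNN rC => /= /eqP ->.
  - by case: u uC => [y|[y j]] // yC; apply: contraNN rC => /= /eqP <-.
  exact: sC.
- move=> C l t sC l_in tC lt; apply: funext => -[x|[x i]] //=.
  congr (q _ x *+ _); apply/setP => y; rewrite !inE andb_idl // => _.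
  apply: contraNneq lt => <-.
  by move: l_in; rewrite inE => /orP[/eqP ->|/mapP[p' _ ->]]; apply/eqP/Lroot.
- move=> C _ sC /mapP[p' p'_in ->].
  by rewrite phi_L // (negPf (p_new _ p'_in)).
by move=> C sC; rewrite phi_L // eqxx.
Qed.

End Lower.

(** * The depth of a whiskered graph *)

Definition independence_number (G : sgraph) : nat :=
  \max_(A : {set G} | stable A) #|A|.

Lemma depth_whisker (k : fieldType) (G : sgraph) m : [pchar k] =i pred0 ->
  (0 < m)%N -> depthE k (whisker G m) = (m * (#|G| - independence_number G))%N.
Proof.
move=> k0 m0; rewrite mulnC.
have s0 : stable (set0 : {set G}) by apply/stableP => u v; rewrite inE.
have [A sA eA] : exists2 A : {set G}, stable A & independence_number G = #|A|.
  have nz : (0 < #|[pred A : {set G} | stable A]|)%N.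
    by apply/card_gt0P; exists set0.
  by have [A sA eA] := eq_bigmax_cond (fun A : {set G} => #|A|) nz; exists A.
apply/eqP; rewrite eqn_leq; apply/andP; split.
  by have := depth_whisker_leq k m0 sA; rewrite cardsCs setCK eA.
apply: depth_whisker_geq => // D sD; rewrite cardsCs setCK; apply: leq_sub2l.
exact: (@leq_bigmax_cond _ (@stable G) (fun A => #|A|)).
Qed.

Theorem theorem3p11 (k : closedFieldType) (hk : [pchar k]%R =i pred0)
    (n : nat) (G : sgraph) (hG : #|G| = n) (m : nat) (hm : (0 < m)%N) :
  depthE k (whisker G m) = (m * depthE k (whisker G 1))%N.
Proof. by rewrite !depth_whisker // mul1n. Qed.
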